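(* Let $G=(V,A)$ be a finite digraph and let $k\ge 1$ be an integer. Let $v_1,\ldots,v_m,v_1$ be a (not necessarily simple) circuit in $G$ that visits every vertex of $G$ at least once. Partition the sequence $v_1,\ldots,v_m$ into contiguous subsequences of length $k$, except for the final subsequence, whose length may be less than $k$; denote the pieces of this partition by $P_1,\ldots,P_\ell$. If, for all $t$, the union of any $t$ of the pieces $P_1,\ldots,P_\ell$ contains at least $t$ distinct vertices, then $G^{2k-1}$ is Hamiltonian.
   Context: A circuit in $G$ is a closed walk $v_1,\ldots,v_m,v_1$ with $\langle v_i,v_{i+1}\rangle\in A$ for $1\le i<m$ and $\langle v_m,v_1\rangle\in A$; vertices and arcs may be repeated. The pieces are $P_1=(v_1,\dots,v_k)$, $P_2=(v_{k+1},\dots,v_{2k})$, and so on; each piece is identified with the set of vertices occurring in it, and ''any $t$ of the pieces'' means any $t$ distinct indices in $\{1,\ldots,\ell\}$ (two pieces may coincide as sets). For a positive integer $q$, $G^q$ is the digraph on $V$ having an arc $\langle u,v\rangle$ whenever $G$ contains a directed path from $u$ to $v$ with at most $q$ arcs. A digraph is Hamiltonian if its vertices can be ordered $w_1,\dots,w_n$, each exactly once, so that $\langle w_i,w_{i+1}\rangle$ for $1\le i<n$ and $\langle w_n,w_1\rangle$ are all arcs (a digraph with a single vertex is regarded as trivially Hamiltonian). *)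

(* Defs.v *)
From mathcomp Require Import all_boot.

Set Implicit Arguments.
Unset Strict Implicit.
Unset Printing Implicit Defensive.

(** A finite digraph is a relation [A : rel V] on a finite type; loops are
    allowed, parallel arcs are not represented. *)

Section Digraph.

Variables (V : finType) (A : rel V).

(** [c] lists v_1, ..., v_m; [cycle] includes the closing arc <v_m, v_1>.
    Since [cycle A [::]] holds, m >= 1 is required separately. *)
Definition circuit (c : seq V) : bool := (c != [::]) && cycle A c.

(** The directed path is u :: p, which has [size p] <= q arcs. The trivial path
    counts, so every vertex of the power carries a loop. *)
Definition digraph_power (q : nat) : rel V :=
  fun u v => [exists p : q.-bseq V,
    [&& path A u p, last u p == v & uniq (u :: p)]].

(** The disjunct [#|V| = 1] is the convention that a one-vertex digraph, even
    without a loop, is Hamiltonian. *)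
Definition hamiltonian : Prop :=
  exists w : seq V, [/\ uniq w, forall x, x \in w & #|V| = 1 \/ cycle A w].

End Digraph.

(** For k > 0 there are ceil(m / k) pieces, where m is the length of [c];
    [reshape] truncates the last piece when k does not divide m. *)
Definition pieces (T : Type) (k : nat) (c : seq T) : seq (seq T) :=
  reshape (nseq ((size c + k.-1) %/ k) k) c.

Lemma flatten_pieces (T : Type) (k : nat) (c : seq T) :
  0 < k -> flatten (pieces k c) = c.
Proof.
move=> k_gt0; apply: reshapeKr; rewrite sumn_nseq mulnC.
have := ltn_ceil (size c + k.-1) k_gt0.
by rewrite mulSn -{2}(prednK k_gt0) addnC addSn ltnS leq_add2l.
Qed.

(* Main.v *)
Require Import Defs.
From mathcomp Require Import all_boot.
From mathcomp Require Import zify.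

(** By Hall's theorem the pieces have distinct representatives.  Assign to each
    vertex one of its positions on the circuit, taking a position inside P_i for
    the representative of P_i.  Every piece then contains an assigned position,
    so cyclically consecutive assigned positions are at most 2k - 1 apart, and
    listing the vertices by position gives the Hamiltonian cycle. *)

(* Rado's argument: as long as some [F i] contains two elements, one of them can
   be deleted without violating the marriage condition. *)
Theorem hall_marriage (I T : finType) (F : I -> {set T}) :
  (forall J : {set I}, #|J| <= #|\bigcup_(i in J) F i|) ->
  exists2 f : I -> T, injective f & forall i, f i \in F i.
Proof.
have [n le_n] := ubnP (\sum_i #|F i|); elim: n => // n IHn in F le_n *.
move=> hallF.
have F_gt0 i : 0 < #|F i| by have := hallF [set i]; rewrite cards1 big_set1.
have [/existsP[i /card_gt1P[x [y [Fix Fiy neq_xy]]]] | /existsPn F_le1] :=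
  boolP [exists i, 1 < #|F i|]; last first.
  have /fin_all_exists[f f_in] : forall i, exists x, x \in F i.
    by move=> i; have /card_gt0P := F_gt0 i.
  exists f => // i j eq_f; apply/eqP/negPn/negP => neq_ij.
  have := hallF [set i; j]; rewrite cards2 neq_ij bigcup_setU !big_set1.
  have Fset1 l : F l = [set f l].
    apply/eqP; rewrite eq_sym eqEcard sub1set f_in cards1 leqNgt.
    exact: F_le1.
  by rewrite !Fset1 eq_f setUid cards1.
pose G z l := if l == i then F i :\ z else F l.
have G_sub z l : G z l \subset F l.
  by rewrite /G; case: eqP => // ->; exact: subsetDl.
have G_neq z (J : {set I}) :
    i \notin J -> \bigcup_(l in J) G z l = \bigcup_(l in J) F l.
  move=> iJ; apply: eq_bigr => l lJ; rewrite /G ifN //.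
  by apply: contraNneq iJ => <-.
have sumG z : z \in F i -> \sum_l #|G z l| < n.
  move=> Fiz; rewrite -ltnS; apply: leq_trans le_n; rewrite ltnS.
  rewrite (bigD1 i) //= [ltnRHS](bigD1 i) //= /G eqxx (cardsD1 z (F i)) Fiz.
  rewrite addSn ltnS leq_add2l leq_eqVlt; apply/orP; left; apply/eqP.
  by apply: eq_bigr => l /negPf->.
have reduce z : z \in F i ->
    (forall J : {set I}, #|J| <= #|\bigcup_(l in J) G z l|) ->
    exists2 f : I -> T, injective f & forall l, f l \in F l.
  move=> Fiz /(IHn _ (sumG z Fiz))[f f_inj f_in]; exists f => // l.
  exact: subsetP (G_sub z l) _ (f_in l).
(* If deleting [z] from [F i] breaks the marriage condition, the violating family must contain [i],
   since the other sets are unchanged. Dropping [i] from it gives [J]. *)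
have violate z :
    ~~ [forall J : {set I}, #|J| <= #|\bigcup_(l in J) G z l|] ->
    exists2 J : {set I}, i \notin J &
      #|(\bigcup_(l in J) F l) :|: (F i :\ z)| <= #|J|.
  case/forallPn=> J; rewrite -ltnNge => ltJ.
  have iJ : i \in J.
    by apply: contraLR ltJ => iJ; rewrite -leqNgt G_neq.
  exists (J :\ i); first by rewrite setD11.
  move: ltJ; rewrite (cardsD1 i J) iJ add1n ltnS; congr (#|_| <= _).
  rewrite (big_setD1 i) //= G_neq ?setD11 // setUC.
  by rewrite /G eqxx.
have [/forallP/(reduce x Fix)// | /violate[J1 iJ1 le1]] :=
  boolP [forall J : {set I}, #|J| <= #|\bigcup_(l in J) G x l|].
have [/forallP/(reduce y Fiy)// | /violate[J2 iJ2 le2]] :=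
  boolP [forall J : {set I}, #|J| <= #|\bigcup_(l in J) G y l|].
(* Contradiction by counting. As [x] and [y] differ, [X1 :|: X2] contains all of [F i], so Hall's
   condition applies to [J1 :|: J2] together with [i], one index more. Adding the bound for
   [J1 :&: J2] gives [#|X1| + #|X2| > #|J1| + #|J2|]. *)
set X1 := _ :|: _ in le1; set X2 := _ :|: _ in le2.
have leU : (#|J1 :|: J2|).+1 <= #|X1 :|: X2|.
  have <- : #|i |: (J1 :|: J2)| = (#|J1 :|: J2|).+1.
    by rewrite cardsU1 inE (negPf iJ1) (negPf iJ2).
  apply: leq_trans (hallF _) (subset_leq_card _).
  rewrite !bigcup_setU big_set1; apply/subsetP=> z; rewrite !inE.
  case: (z =P x) => [-> | _]; last by case/or3P=> ->; rewrite ?orbT.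
  by rewrite neq_xy Fix !orbT.
have leI : #|J1 :&: J2| <= #|X1 :&: X2|.
  apply: leq_trans (hallF _) (subset_leq_card _).
  apply/bigcupsP=> l /setIP[lJ1 lJ2].
  rewrite subsetI /X1 /X2; apply/andP.
  by split; apply: subset_trans (subsetUl _ _); apply: bigcup_sup.
have := cardsUI J1 J2; have := cardsUI X1 X2; lia.
Qed.

Lemma mem_piece (T : eqType) (x0 : T) (k i : nat) (c : seq T) (v : T) :
  v \in nth [::] (pieces k c) i ->
  exists p, [/\ p < size c, p %/ k = i & nth x0 c p = v].
Proof.
rewrite /pieces nth_reshape nth_nseq.
case: ltnP => [lt_i|_]; last by rewrite take0.
rewrite take_nseq ?sumn_nseq 1?ltnW // => /(nthP x0)[j].
rewrite size_take_min size_drop => lt_j <-.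
exists (k * i + j); split; first by lia.
  have lt_jk : j < k by lia.
  by rewrite mulnC divnMDl ?divn_small ?addn0 //; lia.
by rewrite nth_take ?nth_drop //; lia.
Qed.

(** The circuit may repeat vertices, whereas arcs of the power need simple paths; cutting out the
    repetitions of a walk never lengthens it. *)
Lemma digraph_power_walk (V : finType) (A : rel V) (q : nat) (u : V) (p : seq V) :
  path A u p -> size p <= q -> digraph_power A q u (last u p).
Proof.
case/shortenP=> p' Ap' Up' sub_p' le_q.
have le_p' : size p' <= q.
  by apply: leq_trans le_q; apply: uniq_leq_size; case/andP: Up'.
by apply/existsP; exists (Bseq le_p'); rewrite Ap' eqxx.
Qed.

Lemma cycle_nth_mod (T : Type) (A : rel T) (x0 : T) (c : seq T) (j : nat) :
  c <> [::] -> cycle A c ->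
  A (nth x0 c (j %% size c)) (nth x0 c (j.+1 %% size c)).
Proof.
case: c => // x c _ /(pathP x0) cycA.
have lt_j : j %% (size c).+1 < (size c).+1 by rewrite ltn_mod.
have := cycA (j %% (size c).+1); rewrite size_rcons => /(_ lt_j).
rewrite -rcons_cons nth_rcons /= lt_j nth_rcons -(addn1 j) -(modnDml j) addn1.
move: lt_j; rewrite ltnS leq_eqVlt => /predU1P[-> | lt_j].
  by rewrite ltnn eqxx modnn.
by rewrite lt_j (@modn_small (_ %% _).+1).
Qed.

Lemma cycle_digraph_power (V : finType) (A : rel V) (x0 : V) (c : seq V)
    (q j d : nat) :
  c <> [::] -> cycle A c -> d <= q ->
  digraph_power A q (nth x0 c (j %% size c)) (nth x0 c ((j + d) %% size c)).
Proof.
move=> c0 cycA le_d; pose f i := nth x0 c (i %% size c).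
have walk n : path A (f n) (map f (iota n.+1 d)).
  elim: d n {le_d} => //= d IHd n; rewrite IHd andbT; exact: cycle_nth_mod.
rewrite -/(f (j + d)).
have <- : last (f j) (map f (iota j.+1 d)) = f (j + d).
  rewrite last_map; congr f.
  by elim: d j {le_d walk} => [|d IHd] j /=; rewrite ?addn0 // IHd addSnnS.
by apply: digraph_power_walk (walk j) _; rewrite size_map size_iota.
Qed.

(** The successor of [y] in an increasing list is the least larger entry, so any entry in the window
    above [y] bounds the gap; the successor itself need not be identified. *)
Lemma path_bounded_gap (K x : nat) (s : seq nat) :
  path ltn x s ->
  (forall y, y \in x :: s -> y < last x s ->
     exists2 z, z \in s & y < z <= y + K) ->
  path (fun a b => a < b <= a + K) x s.
Proof.
elim: s x => //= y s IHs x /andP[lt_xy y_s] gap.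
have y_min z : z \in s -> y < z.
  by move: z; apply/allP; apply: order_path_min y_s; exact: ltn_trans.
have y_last : y <= last y s.
  by have := mem_last y s; rewrite inE => /predU1P[-> // | /y_min/ltnW].
apply/andP; split.
  have [z] := gap x (mem_head _ _) (leq_trans lt_xy y_last).
  by rewrite inE => /predU1P[-> | /y_min]; lia.
apply: IHs => // a a_ys lt_a.
have [|z] := gap a _ lt_a; first by rewrite inE a_ys orbT.
rewrite inE => /predU1P[-> | z_s] gap_z; last by exists z.
by move: a_ys; rewrite inE => /predU1P[a_y | /y_min]; lia.
Qed.

Theorem lemma2 (V : finType) (A : rel V) (k : nat) (c : seq V) :
  1 <= k ->
  circuit A c ->
  (forall x : V, x \in c) ->
  (forall (t : nat) (I : {set 'I_(size (pieces k c))}),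
     #|I| = t ->
     t <= #|\bigcup_(i in I) [set x in nth [::] (pieces k c) i]|) ->
  hamiltonian (digraph_power A (2 * k - 1)).
Proof.
move=> k_gt0 /andP[/eqP c0 cycA] c_all hallc.
have [x0 _] : exists x0 : V, x0 \in c.
  by case: (c) c0 => // x c' _; exists x; rewrite mem_head.
set m := size c.
have m_gt0 : 0 < m by rewrite lt0n size_eq0; apply/eqP.
have [r r_inj r_in] := hall_marriage _ _ _ (fun I => hallc _ I erefl).
(* The last clause places the representative of a piece inside that piece; it is consistent because
   [r] is injective. Any other vertex takes its first occurrence. *)
have /fin_all_exists[pos pos_spec] : forall v, exists p,
    [/\ p < m, nth x0 c p = v & forall i, r i = v -> p %/ k = i].
  move=> v; have [/codomP[i r_i] | r_v] := boolP (v \in codom r).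
    have := r_in i; rewrite inE -r_i => /(mem_piece _ x0)[p [lt_p p_i p_v]].
    by exists p; split=> // j; rewrite r_i => /r_inj->.
  exists (index v c); rewrite index_mem c_all nth_index //; split=> // i r_i.
  by rewrite -r_i codom_f in r_v.
have posK : cancel pos (nth x0 c) by move=> v; case: (pos_spec v).
have hit p : p < m -> exists v, pos v %/ k = p %/ k.
  move=> lt_p; have lt_i : p %/ k < size (pieces k c).
    rewrite size_reshape size_nseq leq_divRL //.
    have := leq_divM p k; rewrite -/m; lia.
  exists (r (Ordinal lt_i)).
  by case: (pos_spec (r (Ordinal lt_i))) => _ _ /(_ _ erefl).
pose s := sort leq (map pos (enum V)); pose f j := nth x0 c (j %% m).
have mem_s v : pos v \in s by rewrite mem_sort map_f // mem_enum.
have s_pos j : j \in s -> exists2 v, j = pos v & j < m.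
  rewrite mem_sort => /mapP[v _ ->]; exists v => //.
  by case: (pos_spec v).
have s_sorted : sorted ltn s.
  rewrite ltn_sorted_uniq_leq sort_uniq map_inj_uniq ?enum_uniq //=.
    by apply: sort_sorted; exact: leq_total.
  exact: can_inj posK.
have perm_f : perm_eq (map f s) (enum V).
  apply: perm_trans (perm_map f (permEl (perm_sort _ _))) _.
  rewrite -map_comp map_id_in // => v _; rewrite /f /= modn_small ?posK //.
  by case: (pos_spec v).
exists (map f s); split.
- by rewrite (perm_uniq perm_f) enum_uniq.
- by move=> v; rewrite (perm_mem perm_f) mem_enum.
right; case def_s: s s_sorted => [|p0 s'] //= p0_s'.
have p0_min j : j \in s -> p0 <= j.
  rewrite def_s inE => /predU1P[-> // | j_s']; apply: ltnW.
  by move: j j_s'; apply/allP; apply: order_path_min p0_s'; exact: ltn_trans.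
have p0_lt : p0 < k.
  have [v v0] := hit 0 m_gt0.
  apply: leq_ltn_trans (p0_min _ (mem_s v)) _.
  by have := ltn_ceil (pos v) k_gt0; rewrite v0 div0n mul1n.
(* Unrolling the circuit once past its end, the return to [p0] becomes a step up to [p0 + m], so the
   closing gap is treated like the others. *)
have -> : f p0 = f (p0 + m) by rewrite /f modnDr.
rewrite {1}/f modnDr -/(f p0) -map_rcons path_map.
have : path (fun a b => a < b <= a + (2 * k - 1)) p0 (rcons s' (p0 + m)).
  apply: path_bounded_gap.
    rewrite rcons_path p0_s' /=.
    have : last p0 s' \in s by rewrite def_s mem_last.
    by case/s_pos=> _ _; lia.
  move=> y; rewrite last_rcons -rcons_cons mem_rcons -def_s inE.
  case/predU1P=> [-> | y_s _]; first by rewrite ltnn.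
  have [_ _ lt_y] := s_pos y y_s.
  have y_lo := leq_divM y k; have y_hi := ltn_ceil y k_gt0.
  (* With [i = y %/ k], [y] is at least [i * k]. If a next piece exists, its assigned position is at
     most [(i + 2) * k - 1]. Otherwise [m <= (i + 1) * k], and [p0 < k] gives the same bound for
     [p0 + m]. Hence the constant [2 * k - 1]. *)
  have [lt_next | le_m] := ltnP ((y %/ k).+1 * k) m.
    have [v] := hit _ lt_next; rewrite mulnK // => v_k.
    have v_lo := leq_divM (pos v) k; have v_hi := ltn_ceil (pos v) k_gt0.
    rewrite v_k in v_lo v_hi.
    exists (pos v); last by nia.
    have := mem_s v; rewrite def_s mem_rcons !inE => /predU1P[v_p0 | ->].
      (* The list being traversed omits its start [p0], but [pos v] lies in a later piece than [y],
         hence beyond [p0]. *)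
      by have := p0_min y y_s; lia.
    by rewrite orbT.
  exists (p0 + m); first by rewrite mem_rcons mem_head.
  by nia.
apply: sub_path => a b /andP[lt_ab le_b] /=.
rewrite -(subnKC (ltnW lt_ab)); apply: cycle_digraph_power => //; lia.
Qed.
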